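(* Let $A\in\mathbb{H}^{m\times n}$ and $\varepsilon\ge 0$. Assume that the two-sided quaternion MaxVol algorithm uses exact inverses and terminates when no admissible row or column replacement coefficient has modulus larger than $1+\varepsilon$; that is, it terminates at a nonsingular core $B=A[I,J]\in\mathbb{H}^{k\times k}$ such that $|(A[:,J]B^{-1})_{pq}|\le 1+\varepsilon$ for all $p\notin I$ and $1\le q\le k$, and $|(B^{-1}A[I,:])_{qr}|\le 1+\varepsilon$ for all $1\le q\le k$ and $r\notin J$. Then the final core $B$ is $\varepsilon$-quasi-dominant.
   Context: $\mathbb{H}$ is the skew field of real quaternions with modulus $|q|=(q_0^2+q_1^2+q_2^2+q_3^2)^{1/2}$. $I$ and $J$ are lists of $k$ distinct row indices and $k$ distinct column indices; $A[I,J]$, $A[:,J]$, $A[I,:]$ denote the corresponding submatrices (rows/columns in the listed order). Nonsingular means having a two-sided inverse over $\mathbb{H}$. The two-sided quaternion MaxVol algorithm maintains a nonsingular core $B=A[I,J]$ and alternates between replacing a selected row (the $q$th row by a row $p\notin I$, with replacement coefficient $(A[:,J]B^{-1})_{pq}$) and replacing a selected column (the $q$th column by a column $r\notin J$, with replacement coefficient $(B^{-1}A[I,:])_{qr}$) as long as some such admissible coefficient has modulus larger than $1+\varepsilon$. A nonsingular core $B=A[I,J]\in\mathbb{H}^{k\times k}$ is called $\varepsilon$-quasi-dominant if, with $C_B=A[:,J]B^{-1}\in\mathbb{H}^{m\times k}$ and $R_B=B^{-1}A[I,:]\in\mathbb{H}^{k\times n}$, one has $\max_{i,j}|(C_B)_{ij}|\le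 1+\varepsilon$ and $\max_{i,j}|(R_B)_{ij}|\le 1+\varepsilon$, the maxima being over all entries. *)

(* Defs.v *)
From HB Require Import structures.
From mathcomp Require Import all_boot all_order all_algebra.
From mathcomp Require Import ring.
From mathcomp Require Import boolp classical_sets reals.

Set Implicit Arguments.
Unset Strict Implicit.
Unset Printing Implicit Defensive.

Import Order.TTheory GRing.Theory Num.Theory.
Local Open Scope ring_scope.

(* [Quat a b c d] is a + b i + c j + d k. *)
Record quat (R : Type) := Quat { q0 : R; q1 : R; q2 : R; q3 : R }.

Definition tuple_of_quat (R : Type) (x : quat R) : R * R * R * R :=
  (q0 x, q1 x, q2 x, q3 x).
Definition quat_of_tuple (R : Type) (t : R * R * R * R) : quat R :=
  let: (a, b, c, d) := t in Quat a b c d.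

Lemma tuple_of_quatK (R : Type) : cancel (@tuple_of_quat R) (@quat_of_tuple R).
Proof. by case. Qed.

HB.instance Definition _ (R : choiceType) :=
  Choice.copy (quat R) (can_type (@tuple_of_quatK R)).

Section QuatRing.
Variable R : realType.
Local Notation H := (quat R).
Implicit Types x y z : H.

Lemma quatP x y :
  q0 x = q0 y -> q1 x = q1 y -> q2 x = q2 y -> q3 x = q3 y -> x = y.
Proof. by case: x y => ? ? ? ? [? ? ? ?] /= -> -> -> ->. Qed.

Definition quat_add x y : H :=
  Quat (q0 x + q0 y) (q1 x + q1 y) (q2 x + q2 y) (q3 x + q3 y).

Definition quat_opp x : H := Quat (- q0 x) (- q1 x) (- q2 x) (- q3 x).

Lemma quat_addA : associative quat_add.
Proof. by move=> x y z; apply: quatP => /=; ring. Qed.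

Lemma quat_addC : commutative quat_add.
Proof. by move=> x y; apply: quatP => /=; ring. Qed.

Lemma quat_add0 : left_id (Quat 0 0 0 0) quat_add.
Proof. by move=> x; apply: quatP => /=; ring. Qed.

Lemma quat_addN : left_inverse (Quat 0 0 0 0) quat_opp quat_add.
Proof. by move=> x; apply: quatP => /=; ring. Qed.

HB.instance Definition _ :=
  GRing.isZmodule.Build H quat_addA quat_addC quat_add0 quat_addN.

(* i^2 = j^2 = k^2 = ijk = -1 *)
Definition quat_mul x y : H :=
  Quat (q0 x * q0 y - q1 x * q1 y - q2 x * q2 y - q3 x * q3 y)
       (q0 x * q1 y + q1 x * q0 y + q2 x * q3 y - q3 x * q2 y)
       (q0 x * q2 y - q1 x * q3 y + q2 x * q0 y + q3 x * q1 y)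
       (q0 x * q3 y + q1 x * q2 y - q2 x * q1 y + q3 x * q0 y).

Lemma quat_mulA : associative quat_mul.
Proof. by move=> x y z; apply: quatP => /=; ring. Qed.

Lemma quat_mul1l : left_id (Quat 1 0 0 0) quat_mul.
Proof. by move=> x; apply: quatP => /=; ring. Qed.

Lemma quat_mul1r : right_id (Quat 1 0 0 0) quat_mul.
Proof. by move=> x; apply: quatP => /=; ring. Qed.

Lemma quat_mulDl : left_distributive quat_mul +%R.
Proof. by move=> x y z; apply: quatP => /=; ring. Qed.

Lemma quat_mulDr : right_distributive quat_mul +%R.
Proof. by move=> x y z; apply: quatP => /=; ring. Qed.

Lemma quat_one_neq0 : Quat 1 0 0 0 != 0 :> H.
Proof. by apply/eqP => -[] /eqP; rewrite oner_eq0. Qed.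

HB.instance Definition _ :=
  GRing.Zmodule_isNzRing.Build H quat_mulA quat_mul1l quat_mul1r
    quat_mulDl quat_mulDr quat_one_neq0.

Definition quat_sqnorm x : R := q0 x ^+ 2 + q1 x ^+ 2 + q2 x ^+ 2 + q3 x ^+ 2.

Definition quat_norm x : R := Num.sqrt (quat_sqnorm x).

Definition quat_inv x : H :=
  Quat (q0 x / quat_sqnorm x) (- q1 x / quat_sqnorm x)
       (- q2 x / quat_sqnorm x) (- q3 x / quat_sqnorm x).

Lemma quat_sqnorm_neq0 x : x != 0 -> quat_sqnorm x != 0.
Proof.
apply: contra => /eqP; rewrite /quat_sqnorm => /eqP.
rewrite !paddr_eq0 ?addr_ge0 ?sqr_ge0 // !sqrf_eq0.
by move=> /andP[/andP[/andP[/eqP a /eqP b] /eqP c] /eqP d]; apply/eqP/quatP.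
Qed.

(* every nonzero element is invertible: H is a skew field *)
Lemma quat_mulVl x : x != 0 -> quat_inv x * x = 1.
Proof.
move=> /quat_sqnorm_neq0; rewrite /quat_sqnorm => nx.
by apply: quatP; rewrite /= /quat_sqnorm; field.
Qed.

Lemma quat_mulVr x : x != 0 -> x * quat_inv x = 1.
Proof.
move=> /quat_sqnorm_neq0; rewrite /quat_sqnorm => nx.
by apply: quatP; rewrite /= /quat_sqnorm; field.
Qed.

Lemma quat_inv_unitP x y : y * x = 1 /\ x * y = 1 -> x != 0.
Proof.
by case=> yx _; apply: contraPneq yx => ->; rewrite mulr0 => /esym/eqP;
  rewrite oner_eq0.
Qed.

Lemma quat_inv_out x : ~~ (x != 0) -> quat_inv x = x.
Proof.
by rewrite negbK => /eqP ->; apply: quatP; rewrite /= ?oppr0 mul0r.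
Qed.

HB.instance Definition _ :=
  GRing.NzRing_hasMulInverse.Build H quat_mulVl quat_mulVr quat_inv_unitP
    quat_inv_out.

End QuatRing.

Section QuatMatrix.
Variable R : realType.
Local Notation H := (quat R).

(* [invmx] is only available over commutative rings. *)
Definition is_inverse_qmx k (B X : 'M[H]_k) : Prop :=
  B *m X = 1%:M /\ X *m B = 1%:M.

Definition nonsingular_qmx k (B : 'M[H]_k) : Prop :=
  exists X : 'M[H]_k, is_inverse_qmx B X.

(* the two-sided inverse of B if B is nonsingular, and 0 otherwise *)
Definition invqmx k (B : 'M[H]_k) : 'M[H]_k :=
  xget 0 [set X | is_inverse_qmx B X]%classic.

Lemma invqmxP k (B : 'M[H]_k) :
  nonsingular_qmx B -> is_inverse_qmx B (invqmx B).
Proof. exact: (@xgetPex _ 0 [set X | is_inverse_qmx B X]%classic). Qed.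

Lemma invqmx_unique k (B X : 'M[H]_k) : is_inverse_qmx B X -> invqmx B = X.
Proof.
move=> BX; have [_ YB] := @invqmxP _ B (ex_intro _ X BX).
by case: BX => BX _; rewrite -[invqmx B]mulmx1 -BX mulmxA YB mul1mx.
Qed.

(* 0 is neutral here since moduli are nonnegative. *)
Definition max_modulus m n (M : 'M[H]_(m, n)) : R :=
  \big[Num.max/0]_(i < m) \big[Num.max/0]_(j < n) quat_norm (M i j).

Variables (m n k : nat) (A : 'M[H]_(m, n)).

Definition selected_cols (J : k.-tuple 'I_n) : 'M[H]_(m, k) :=
  colsub (tnth J) A.

Definition selected_rows (I : k.-tuple 'I_m) : 'M[H]_(k, n) :=
  rowsub (tnth I) A.

Definition core (I : k.-tuple 'I_m) (J : k.-tuple 'I_n) : 'M[H]_k :=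
  mxsub (tnth I) (tnth J) A.

Definition col_coef (I : k.-tuple 'I_m) (J : k.-tuple 'I_n) : 'M[H]_(m, k) :=
  selected_cols J *m invqmx (core I J).

Definition row_coef (I : k.-tuple 'I_m) (J : k.-tuple 'I_n) : 'M[H]_(k, n) :=
  invqmx (core I J) *m selected_rows I.

Definition quasi_dominant (eps : R) (I : k.-tuple 'I_m) (J : k.-tuple 'I_n) :
    Prop :=
  [/\ nonsingular_qmx (core I J),
      max_modulus (col_coef I J) <= 1 + eps
    & max_modulus (row_coef I J) <= 1 + eps].

End QuatMatrix.

(* Main.v *)
(** On a selected row p = I_i, the coefficients [A[:,J] B^-1] form row i of
    [B B^-1 = 1], and dually for the selected columns.  The entries of the
    identity have modulus at most [1 <= 1 + eps], and the stopping conditions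
    bound all the other entries. *)
Require Import Defs.
From mathcomp Require Import all_boot all_order all_algebra.
From mathcomp Require Import reals.

Import Order.TTheory GRing.Theory Num.Theory.
Local Open Scope ring_scope.

(** Entries of the identity matrix have the form [b%:R]; this bounds the coefficients on selected
    rows and columns. *)
Lemma quat_norm_bool_le1 (R : realType) (b : bool) :
  quat_norm (b%:R : quat R) <= 1.
Proof.
by case: b; rewrite /quat_norm /quat_sqnorm /= ?expr1n !expr0n /= !addr0
  ?sqrtr1 // sqrtr0 ler01.
Qed.

(** [0 <= c] handles the initial value 0 of both iterated maxima. *)
Lemma max_modulus_le (R : realType) (m n : nat) (M : 'M[quat R]_(m, n))
    (c : R) :
  0 <= c -> (forall i j, quat_norm (M i j) <= c) -> max_modulus M <= c.
Proof. by move=> c_ge0 leMc; do 2![apply: bigmax_le => // ? _]. Qed.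

Section SelectedCoefficients.
Variables (R : realType) (m n k : nat) (A : 'M[quat R]_(m, n)).
Variables (I : k.-tuple 'I_m) (J : k.-tuple 'I_n).
Hypothesis nonsing : nonsingular_qmx (core A I J).

Lemma col_coef_selected (i q : 'I_k) :
  col_coef A I J (tnth I i) q = (i == q)%:R.
Proof.
have [BX _] := invqmxP nonsing.
have <- : (1%:M : 'M[quat R]_k) i q = (i == q)%:R by rewrite mxE.
(* With 1 expanded as [B *m invqmx B], the sums agree termwise: row [tnth I i] of
   [selected_cols A J] is row [i] of the core. *)
by rewrite -BX !mxE; apply: eq_bigr => j _; rewrite !mxE.
Qed.

Lemma row_coef_selected (q j : 'I_k) :
  row_coef A I J q (tnth J j) = (q == j)%:R.
Proof.
(* Columns need the left inverse identity, since [invqmx] now multiplies on the left. *)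
have [_ XB] := invqmxP nonsing.
have <- : (1%:M : 'M[quat R]_k) q j = (q == j)%:R by rewrite mxE.
by rewrite -XB !mxE; apply: eq_bigr => i _; rewrite !mxE.
Qed.

End SelectedCoefficients.

Theorem proposition2 (R : realType) (m n k : nat) (A : 'M[quat R]_(m, n))
    (eps : R) (eps_ge0 : 0 <= eps)
    (I : k.-tuple 'I_m) (J : k.-tuple 'I_n)
    (uniqI : uniq I) (uniqJ : uniq J)
    (nonsing : nonsingular_qmx (core A I J))
    (row_stop : forall (p : 'I_m) (q : 'I_k), p \notin I ->
       quat_norm ((selected_cols A J *m invqmx (core A I J)) p q) <= 1 + eps)
    (col_stop : forall (q : 'I_k) (r : 'I_n), r \notin J ->
       quat_norm ((invqmx (core A I J) *m selected_rows A I) q r) <= 1 + eps) :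
  quasi_dominant A eps I J.
Proof.
have le1 : 1 <= 1 + eps by rewrite lerDl.
have ge0 : 0 <= 1 + eps by apply: le_trans le1; exact: ler01.
split=> //; apply: max_modulus_le => //.
- move=> p q; have [/tnthP[i ->] | pI] := boolP (p \in I); last exact: row_stop.
  by rewrite col_coef_selected //; exact: le_trans (quat_norm_bool_le1 _ _) le1.
- move=> q r; have [/tnthP[j ->] | rJ] := boolP (r \in J); last exact: col_stop.
  by rewrite row_coef_selected //; exact: le_trans (quat_norm_bool_le1 _ _) le1.
Qed.
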